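(* Let $R$ be a Prüfer domain such that every proper ideal of $R$ has only finitely many minimal primes. Then $\star=\widehat{\star}$ for every stable semistar operation $\star$ on $R$, where $\widehat{\star}$ is the normalized stable version of $\star$.
   Context: Let $R$ be an integral domain with quotient field $K$, and let $\mathbf{F}(R)$ be the set of $R$-submodules of $K$. For submodules $A,B$ of $K$, $(A:B):=\{x\in K\mid xB\subseteq A\}$. A semistar operation on $R$ is a map $\star:\mathbf{F}(R)\to\mathbf{F}(R)$, $I\mapsto I^\star$, such that for all $I,J\in\mathbf{F}(R)$ and $x\in K$: (1) $I\subseteq I^\star$; (2) $I^\star=(I^\star)^\star$; (3) if $I\subseteq J$ then $I^\star\subseteq J^\star$; (4) $(xI)^\star=x\cdot I^\star$. It is stable if $(I\cap J)^\star=I^\star\cap J^\star$ for all $I,J\in\mathbf{F}(R)$. For a stable semistar operation $\star$ on $R$: the quasi-spectrum $\mathrm{QSpec}^{\star}(R)$ is the set of primes $P$ of $R$ with $P=P^\star\cap R$; the pseudo-spectrum $\mathrm{PsSpec}^{\star}(R)$ is the set of primes $P$ of $R$ such that $P^\star\cap R=R$ (i.e. $P^\star=R^\star$) and $L^\star\cap R=L$ for some $P$-primary ideal $L$ of $R$. If $R$ is a Prüfer domain, the normalized stable version of $\star$ is the map $\widehat{\star}:\mathbf{F}(R)\to\mathbf{F}(R)$ given by $I^{\widehat{\star}}:=\bigcap_{P\in\mathrm{QSpec}^{\star}(R)}IR_P\cap\bigcap_{P\in\mathrm{PsSpec}^{\star}(R)}(IR_P)^{v_{R_P}}$, where $v_{R_P}$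 is the $v$-operation on $R_P$, $H^{v_{R_P}}:=(R_P:(R_P:H))$. A minimal prime of an ideal $I$ is a prime ideal of $R$ minimal among those containing $I$. *)

(* Defs.v *)
From HB Require Import structures.
From mathcomp Require Import all_boot all_order all_algebra.
From mathcomp Require Import boolp classical_sets functions cardinality.

Set Implicit Arguments.
Unset Strict Implicit.
Unset Printing Implicit Defensive.

Import GRing.Theory.
Local Open Scope classical_set_scope.
Local Open Scope ring_scope.

Notation "x %:F" := (@FracField.tofrac _ x) : ring_scope.

(* The quotient field of R is {fraction R}. Subsets of R and of its quotient
   field are classical sets, so that equality of subsets is Leibniz equality. *)

Section Submodules.
Variable R : idomainType.
Implicit Types (A B : set {fraction R}) (I : set R).

Definition is_submodule A : Prop :=
  A 0 /\ forall (r : R) x y, A x -> A y -> A (r%:F * x + y).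

Definition scale_sub (x : {fraction R}) A : set {fraction R} :=
  (fun y => x * y) @` A.

Definition prod_sub A B : set {fraction R} :=
  [set x | exists n (a b : 'I_n -> {fraction R}),
    [/\ forall i, A (a i), forall i, B (b i) & x = \sum_(i < n) a i * b i]].

Definition colon A B : set {fraction R} :=
  [set x | scale_sub x B `<=` A].

Definition embed I : set {fraction R} := [set r%:F | r in I].

Definition contract A : set R := [set r | A r%:F].

End Submodules.

Section Ideals.
Variable R : idomainType.
Implicit Types (I L P Q : set R).

(* idealr_closed includes 1 \notin I. *)
Definition is_proper_ideal I : Prop := idealr_closed (mem I).

Definition is_prime_ideal P : Prop :=
  is_proper_ideal P /\ prime_idealr_closed (mem P).

Definition minimal_prime I P : Prop :=
  [/\ is_prime_ideal P, I `<=` P &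
      forall Q, is_prime_ideal Q -> I `<=` Q -> Q `<=` P -> Q = P].

Definition radical I : set R := [set x | exists n : nat, I (x ^+ n)].

Definition is_primary_ideal I : Prop :=
  is_proper_ideal I /\ forall x y, I (x * y) -> I x \/ radical I y.

Definition is_primary_for P L : Prop :=
  is_primary_ideal L /\ radical L = P.

Definition fg_ideal n (a : 'I_n -> R) : set R :=
  [set x | exists c : 'I_n -> R, x = \sum_(i < n) c i * a i].

Definition invertible (A : set {fraction R}) : Prop :=
  exists2 B, is_submodule B & prod_sub A B = embed setT.

(* The localization R_P, as a subset of the quotient field. *)
Definition localization P : set {fraction R} :=
  [set x | exists a s : R, ~ P s /\ x = a%:F / s%:F].

End Ideals.

(* Every nonzero finitely generated ideal is invertible. *)
Definition is_prufer (R : idomainType) : Prop :=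
  forall n (a : 'I_n -> R), (exists i, a i != 0) ->
    invertible (embed (fg_ideal a)).

Section Semistar.
Variable R : idomainType.
Implicit Types (I J : set {fraction R}) (P : set R).

(* A self-map of the set of submodules is represented by a map on all subsets
   of the quotient field, of which only the values at submodules matter. *)
Definition is_semistar (star : set {fraction R} -> set {fraction R}) : Prop :=
  [/\ forall I, is_submodule I -> is_submodule (star I),
      forall I, is_submodule I -> I `<=` star I,
      forall I, is_submodule I -> star I = star (star I),
      forall I J, is_submodule I -> is_submodule J ->
        I `<=` J -> star I `<=` star J &
      forall x I, is_submodule I ->
        star (scale_sub x I) = scale_sub x (star I)].

Definition is_stable (star : set {fraction R} -> set {fraction R}) : Prop :=
  forall I J, is_submodule I -> is_submodule J ->
    star (I `&` J) = star I `&` star J.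

Variable star : set {fraction R} -> set {fraction R}.

Definition QSpec : set (set R) :=
  [set P | is_prime_ideal P /\ P = contract (star (embed P))].

Definition PsSpec : set (set R) :=
  [set P | [/\ is_prime_ideal P, contract (star (embed P)) = setT &
     exists2 L, is_primary_for P L & contract (star (embed L)) = L]].

Definition v_op (D H : set {fraction R}) : set {fraction R} :=
  colon D (colon D H).

Definition normalized_stable I : set {fraction R} :=
  (\bigcap_(P in QSpec) prod_sub I (localization P)) `&`
  (\bigcap_(P in PsSpec) v_op (localization P) (prod_sub I (localization P))).

End Semistar.

(* Main.v *)
Require Import Defs.
From mathcomp Require Import all_boot all_order all_algebra.
From mathcomp Require Import boolp classical_sets functions cardinality.
From mathcomp Require Import ring.

Set Implicit Arguments.
Unset Strict Implicit.
Unset Printing Implicit Defensive.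

Import GRing.Theory.
Local Open Scope classical_set_scope.
Local Open Scope ring_scope.

(** A stable semistar operation is recorded by the set [D] of the ideals [J]
    with [1] in [star J]: stability gives [x \in star I] exactly when the ideal
    [(I :_R x)] belongs to [D] ([star_denominators]), and [D] is a Gabriel
    filter ([star_gabriel]).  A prime lies in the quasi-spectrum exactly when
    it is outside [D] ([QSpecP]), and in the pseudo-spectrum exactly when it is
    in [D] and has a primary ideal closed for the associated closure
    ([PsSpecP]).  Membership of [x] in [I R_P] and in [(I R_P)^v] also depends
    only on [J = (I :_R x)]: the first says that [J] is not contained in [P]
    ([prod_localizationP]), the second that [J] is not contained in [m R_P] for
    any nonzero [m \in P] ([v_op_not_multiples], which uses that [R_P] is a
    valuation ring).  The theorem thus becomes: [J] is in [D] iff it satisfies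
    these conditions for all primes of the two spectra.

    If [J] is in [D], it is not inside a prime outside [D]; and if it were
    inside [m R_P], all ideals [m ^ n R_P \cap R] would be in [D], hence so
    would any [P]-primary ideal, since it contains one of them
    ([loc_multiples_nonmember]).

    Conversely, suppose [J] is not in [D], and replace it by its closure [J'].
    If some minimal prime of [J'] is outside [D], the first condition fails.
    Otherwise let [P] be a minimal prime.  There are finitely many others, each
    comaximal with [P] because incomparable primes of a Prufer domain are
    comaximal; so [P] can be split off: for a suitable [e] outside [P], the
    closed ideal [L = (J' :_R e ^ N)] has [P] as its least prime over-ideal.
    For [s] outside [P], each ideal containing [L] and [s] contains [P] (checked
    locally, where ideals are totally ordered), hence is in [D]; as [L] is
    closed, this makes it [P]-primary ([closed_primary]).  So [P] is in the
    pseudo-spectrum, and the second condition would give [P] inside [L], which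
    is absurd since [P] is in [D] and [L] is not ([gabriel_obstruction],
    [prime_sub_primary]).

    The Prufer hypothesis enters through one elementwise consequence,
    [elementwise_prufer], which expresses that any two elements are comparable
    for divisibility in every localization at a prime. *)

(** * Maximal sets above a given one *)

(** The union of an empty chain need not satisfy [P]; asking only that the
    maximal set lie above [A0] lets [A0] bound that chain. *)
Lemma Zorn_above T (P : set (set T)) (A0 : set T) :
    P A0 ->
    (forall F : set (set T), F !=set0 -> F `<=` P -> total_on F subset ->
       P (\bigcup_(X in F) X)) ->
  exists A, [/\ P A, A0 `<=` A & forall B, A `<=` B -> P B -> B `<=` A].
Proof.
move=> PA0 chain; have [F FP Ftot|A [PA maxA]] :=
  @Zorn_bigcup _ [set X | P (A0 `|` X)].
  have [[X0 FX0]|F0] := pselect (F !=set0); last first.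
    rewrite /= (_ : \bigcup_(X in F) X = set0) ?setU0//.
    by apply: bigcup0 => X FX; case: F0; exists X.
  rewrite /= (_ : _ `|` _ = \bigcup_(Y in [set A0 `|` X | X in F]) Y).
    apply: chain; first by exists (A0 `|` X0); exists X0.
      by move=> _ [X FX <-]; exact: FP.
    move=> _ _ [X FX <-] [Y FY <-].
    by case: (Ftot _ _ FX FY) => XY; [left|right]; exact: setUS.
  apply/seteqP; split => x.
    by case=> [A0x|[X FX Xx]]; [exists (A0 `|` X0)|exists (A0 `|` X)];
      [exists X0|left|exists X|right].
  by case=> _ [X FX <-] [A0x|Xx]; [left|right; exists X].
exists (A0 `|` A); split=> [//|x ?|B AB PB x Bx]; first by left.
apply: contrapT => nx; apply: (maxA B); last first.
  by rewrite /= setUidr // => y A0y; apply: AB; left.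
split=> [y Ay|BA]; first by apply: AB; right.
by apply: nx; right; exact: BA.
Qed.

(** * Ideals and primes *)

Section Ideals.
Variable R : idomainType.
Implicit Types (A B J L P Q : set R) (a b r s t x y : R).

(** Unlike the proper ideals of the statement, these may contain [1]: ideals
    such as [(J :_R x)] are often the whole ring. *)
Definition ideal J := J 0 /\ forall r x y, J x -> J y -> J (r * x + y).

Lemma idealMl J r x : ideal J -> J x -> J (r * x).
Proof. by case=> J0 Jl Jx; rewrite -[_ * _]addr0; exact: Jl. Qed.

Lemma idealMr J r x : ideal J -> J x -> J (x * r).
Proof. by rewrite mulrC; exact: idealMl. Qed.

Lemma idealD J x y : ideal J -> J x -> J y -> J (x + y).
Proof. by case=> _ Jl Jx Jy; rewrite -[x]mul1r; exact: Jl. Qed.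

Lemma ideal_setT : ideal setT. Proof. by []. Qed.

Lemma ideal1 J : ideal J -> J 1 -> J = setT.
Proof.
by move=> iJ J1; apply/seteqP; split=> // x _; rewrite -[x]mulr1; exact: idealMl.
Qed.

Lemma proper_idealP J : is_proper_ideal J <-> ideal J /\ ~ J 1.
Proof.
rewrite /is_proper_ideal; split=> [[J0 J1 Jl]|[[J0 Jl] J1]].
  split; last by move=> /mem_set J1'; move/negP: J1; apply.
  split; first exact: set_mem.
  by move=> r x y Jx Jy; apply/set_mem/Jl; exact: mem_set.
split; [exact: mem_set|by apply/negP => /set_mem|].
by move=> r x y /set_mem Jx /set_mem Jy; apply: mem_set; exact: Jl.
Qed.

Lemma prime_idealP P :
  is_prime_ideal P <->
  [/\ ideal P, ~ P 1 & forall x y, P (x * y) -> P x \/ P y].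
Proof.
rewrite /is_prime_ideal proper_idealP; split=> [[[iP P1] Pm]|[iP P1 Pm]].
  split=> // x y Pxy; have /orP[/set_mem|/set_mem] := Pm _ _ (mem_set Pxy);
    by [left|right].
split=> // x y /set_mem /Pm[Px|Py]; apply/orP;
  by [left; exact: mem_set|right; exact: mem_set].
Qed.

Lemma prime_ideal P : is_prime_ideal P -> ideal P.
Proof. by case/prime_idealP. Qed.

Lemma prime_one P : is_prime_ideal P -> ~ P 1.
Proof. by case/prime_idealP. Qed.

Lemma primeM P x y : is_prime_ideal P -> P (x * y) -> P x \/ P y.
Proof. by case/prime_idealP => _ _; apply. Qed.

Lemma primeMn P x y : is_prime_ideal P -> ~ P x -> ~ P y -> ~ P (x * y).
Proof. by move=> pP ? ? /(primeM pP)[]. Qed.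

Lemma primeX P x n : is_prime_ideal P -> P (x ^+ n) -> P x.
Proof.
move=> pP; elim: n => [/(prime_one pP)//|n IH].
by rewrite exprS => /(primeM pP)[].
Qed.

Lemma prime_one_minus P t : is_prime_ideal P -> P t -> ~ P (1 - t).
Proof.
move=> pP Pt P1t; apply: (prime_one pP).
by rewrite (_ : 1 = 1 - t + t); [apply: idealD (prime_ideal pP) _ _|ring].
Qed.

Lemma ideal_bigcup (F : set (set R)) :
  F !=set0 -> F `<=` ideal -> total_on F subset -> ideal (\bigcup_(X in F) X).
Proof.
move=> [X0 FX0] Fi Ftot; split; first by exists X0 => //; case: (Fi _ FX0).
move=> r x y [X FX Xx] [Y FY Yy].
case: (Ftot _ _ FX FY) => XY; [exists Y|exists X] => //.
  by case: (Fi _ FY) => _; apply=> //; exact: XY.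
by case: (Fi _ FX) => _; apply=> //; exact: XY.
Qed.

(** Maximal ideals disjoint from a multiplicative set are prime: ideals strictly
    above [Q] through [u] and through [v] contain powers of [x], and the product
    of these powers would lie in [Q] if [u * v] did. *)
Lemma ex_prime_avoiding J x :
    ideal J -> (forall n, ~ J (x ^+ n)) ->
  exists Q, [/\ is_prime_ideal Q, J `<=` Q & ~ Q x].
Proof.
move=> iJ Jx.
have [|F F0 Fp Ftot|Q [[iQ Qx] JQ maxQ]] :=
    @Zorn_above _ [set A | ideal A /\ forall n, ~ A (x ^+ n)] J.
- by split.
- split; first by apply: ideal_bigcup => // X /Fp[].
  by move=> n [X /Fp[_ /(_ n)]].
exists Q; split=> //; last exact: (Qx 1%N).
have meet y : ~ Q y -> exists n q r, Q q /\ x ^+ n = r * y + q.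
  move=> Qy; apply: contrapT => H; apply: Qy.
  apply: (maxQ [set z | exists q r, Q q /\ z = r * y + q]).
  - by move=> z Qz; exists z, 0; rewrite mul0r add0r.
  - split; last by move=> n [q [r [Qq E]]]; apply: H; exists n, q, r.
    split; first by exists 0, 0; split; [case: iQ|rewrite mul0r addr0].
    move=> r _ _ [q1 [r1 [Qq1 ->]]] [q2 [r2 [Qq2 ->]]].
    exists (r * q1 + q2), (r * r1 + r2); split; last by ring.
    by case: iQ => _; apply.
  - by exists 0, 1; split; [case: iQ|rewrite mul1r addr0].
apply/prime_idealP; split=> //; first exact: (Qx 0%N).
move=> u v Quv; apply: contrapT => /not_orP[/meet[n [q [r [Qq En]]]]].
move=> /meet[m [q' [r' [Qq' Em]]]]; apply: (Qx (n + m)%N).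
rewrite exprD En Em (_ : _ * _ =
  (r * r') * (u * v) + (q * (r' * v) + (q' * (r * u) + q * q'))); last by ring.
by repeat apply: idealD => //; [exact: idealMl|exact: idealMr..].
Qed.

(** Chains of primes have a prime intersection; Zorn is applied to the
    complements. *)
Lemma ex_minimal_prime J Q :
  is_prime_ideal Q -> J `<=` Q -> exists2 P, minimal_prime J P & P `<=` Q.
Proof.
move=> pQ JQ.
have [||A [[pA JA] QA maxA]] :=
    @Zorn_above _ [set X | is_prime_ideal (~` X) /\ J `<=` ~` X] (~` Q).
- by rewrite /= setCK.
- move=> F [X0 FX0] Fp Ftot; split; last first.
    by move=> x Jx [X FX Xx]; case: (Fp _ FX) => _ /(_ _ Jx).
  have pF X : F X -> is_prime_ideal (~` X) by move=> /Fp[].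
  apply/prime_idealP; split.
  + split; first by move=> [X FX]; case: (prime_ideal (pF _ FX)).
    move=> r x y nx ny [X FX Xz]; move: (Xz).
    case: (prime_ideal (pF _ FX)) => _; apply=> [Xx|Xy];
      by [apply: nx; exists X|apply: ny; exists X].
  + move=> n1; apply: (prime_one (pF _ FX0)) => X01.
    by apply: n1; exists X0.
  + move=> x y nxy; apply: contrapT => /not_orP[/contrapT[X FX Xx]].
    move=> /contrapT[Y FY Yy].
    suff [Z [FZ Zx Zy]] : exists Z, [/\ F Z, Z x & Z y].
      apply: (@primeMn (~` Z) x y (pF _ FZ)) => [/(_ Zx)//|/(_ Zy)//|Zxy].
      by apply: nxy; exists Z.
    by case: (Ftot _ _ FX FY) => XY; [exists Y|exists X]; split=> //; exact: XY.
exists (~` A); last by move=> x nAx; apply: contrapT => Qx; apply: nAx; exact: QA.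
split=> // P pP JP PA; apply/seteqP; split=> // x nAx.
apply: contrapT => Px; apply: nAx; apply: (maxA (~` P)) => //.
  by move=> y Ay Py; exact: (PA _ Py).
by rewrite /= setCK.
Qed.

(** * Comparability in Prufer domains *)

(** For a prime [P], one of [t] and [1 - t] is outside [P], so [a] divides [b] or
    [b] divides [a] in [R_P]: all localizations are valuation rings. *)
Definition elementwise_prufer := forall a b, exists t r1 r2,
  t * b = r1 * a /\ (1 - t) * a = r2 * b.

Definition comaximal P Q := exists2 e, Q e & P (1 - e).

(** If [b \in Q] is outside [P] and [a \in P] outside [Q], the relations
    [t * a = r1 * b] and [(1 - t) * b = r2 * a] force [t] into [Q] and [1 - t]
    into [P]. *)
Lemma incomparable_comaximal P Q : elementwise_prufer ->
  is_prime_ideal P -> is_prime_ideal Q -> ~ P `<=` Q -> ~ Q `<=` P ->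
  comaximal P Q.
Proof.
move=> pr pP pQ /existsNP[a /not_implyP[Pa Qa]].
move=> /existsNP[b /not_implyP[Qb Pb]].
have [t [r1 [r2 [E1 E2]]]] := pr b a.
exists t.
  have : Q (t * a) by rewrite E1; exact: idealMl (prime_ideal pQ) _.
  by case/(primeM pQ).
have : P ((1 - t) * b) by rewrite E2; exact: idealMl (prime_ideal pP) _.
by case/(primeM pP).
Qed.

Lemma comaximal_seq P (s : seq (set R)) : ideal P ->
  (forall Q, Q \in s -> ideal Q /\ comaximal P Q) ->
  exists2 e, (forall Q, Q \in s -> Q e) & P (1 - e).
Proof.
move=> iP; elim: s => [_|Q s IH H].
  by exists 1 => //; rewrite subrr; case: iP.
have [Q' Q's|e1 e1s P1] := IH; first by apply: H; rewrite in_cons Q's orbT.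
have [iQ [e2 Qe2 P2]] := H Q (mem_head _ _).
exists (e1 * e2).
  move=> Q'; rewrite in_cons => /orP[/eqP->|Q's]; first exact: idealMl.
  apply: idealMr (e1s _ Q's).
  by case: (H Q') => //; rewrite in_cons Q's orbT.
rewrite (_ : 1 - _ = e1 * (1 - e2) + (1 - e1)); last by ring.
by case: iP => _; apply.
Qed.

(** The colon ideal [(J :_R x)]. *)
Definition conductor J x := [set r | J (r * x)].

Lemma ideal_conductor J x : ideal J -> ideal (conductor J x).
Proof.
move=> [J0 Jl]; split; first by rewrite /conductor/= mul0r.
by move=> r y z; rewrite /conductor/= mulrDl -mulrA; exact: Jl.
Qed.

Lemma sub_conductor J x : ideal J -> J `<=` conductor J x.
Proof. by move=> iJ r Jr; exact: idealMr. Qed.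

Lemma conductor_mem J x : ideal J -> J x -> conductor J x = setT.
Proof.
by move=> iJ Jx; apply: ideal1; [exact: ideal_conductor|rewrite /conductor/= mul1r].
Qed.

(** A local check.  If [p \in P] were not in [(L :_R x)], some prime [M] would
    contain all [t] with [t * p] in [(L :_R x)].  Then [M] contains [L], hence
    [P], and in the valuation ring [R_M] the element [s], outside [P], divides
    [p]; but [s] is in [(L :_R x)]. *)
Lemma least_prime_sub_conductor L P x s : elementwise_prufer ->
  ideal L -> is_prime_ideal P ->
  (forall Q, is_prime_ideal Q -> L `<=` Q -> P `<=` Q) ->
  ~ P s -> L (s * x) -> P `<=` conductor L x.
Proof.
move=> pr iL pP least Ps Lsx p Pp; apply: contrapT => Lp.
set C := conductor (conductor L x) p.
have iC : ideal C by do 2! apply: ideal_conductor.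
have [n|M [pM CM _]] := @ex_prime_avoiding C 1 iC.
  by rewrite expr1n /C /conductor /= mul1r.
have LC : L `<=` C.
  apply: subset_trans (sub_conductor x iL) _.
  by apply: sub_conductor; exact: ideal_conductor.
have PM : P `<=` M by apply: least => //; exact: subset_trans CM.
have [t [r1 [r2 [E1 E2]]]] := pr s p.
have Mt : M t.
  apply: CM; rewrite /C /conductor /= E1 -mulrA; exact: idealMl.
have M1t : M (1 - t).
  apply: PM; have : P ((1 - t) * s) by rewrite E2; exact: idealMl (prime_ideal pP) _.
  by case/(primeM pP).
exact: (prime_one_minus pM Mt M1t).
Qed.

(** * Gabriel filters *)

(** Upward closure is the case of [B] above [A] in the second axiom. *)
Record gabriel_filter (D : set (set R)) : Prop := Gabriel {
  gabrielT : D setT;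
  gabriel_trans : forall A B, ideal A -> ideal B -> D A ->
    (forall a, A a -> D (conductor B a)) -> D B }.

Section Gabriel.
Variables (D : set (set R)) (gD : gabriel_filter D).

Lemma gabriel_sub A B : ideal A -> ideal B -> A `<=` B -> D A -> D B.
Proof.
move=> iA iB AB DA; apply: (gabriel_trans gD iA iB DA) => a /AB Ba.
by rewrite conductor_mem//; exact: gabrielT.
Qed.

Lemma gabrielI A B : ideal A -> ideal B -> D A -> D B -> D (A `&` B).
Proof.
move=> iA iB DA DB.
have iAB : ideal (A `&` B).
  case: iA iB => [A0 Al] [B0 Bl]; split=> // r x y [Ax Bx] [Ay By].
  by split; [exact: Al|exact: Bl].
apply: (gabriel_trans gD iA) => // a Aa; apply: (gabriel_sub iB) DB.
  exact: ideal_conductor.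
by move=> b Bb; split; [exact: idealMl|exact: idealMr].
Qed.

Definition gabriel_closed J := forall x, D (conductor J x) -> J x.

Definition gabriel_closure J := [set x | D (conductor J x)].

Lemma conductorM J x y : conductor (conductor J x) y = conductor J (y * x).
Proof. by apply/seteqP; split=> r; rewrite /conductor/= mulrA. Qed.

Lemma closed_conductor J x : gabriel_closed J -> gabriel_closed (conductor J x).
Proof. by move=> cJ y; rewrite conductorM => /cJ. Qed.

Lemma sub_closure J : ideal J -> J `<=` gabriel_closure J.
Proof.
by move=> iJ x Jx; rewrite /gabriel_closure/= conductor_mem//; exact: gabrielT.
Qed.

Lemma ideal_closure J : ideal J -> ideal (gabriel_closure J).
Proof.
move=> iJ; split; first by apply: sub_closure => //; case: iJ.
move=> r x y Dx Dy; have ic := ideal_conductor _ iJ.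
apply: (gabriel_sub _ _ _ (gabrielI (ic x) (ic y) Dx Dy)) => //.
  case: (ic x) (ic y) => [? xl] [? yl]; split=> // ? ? ? [? ?] [? ?].
  by split; [exact: xl|exact: yl].
move=> s [Jsx Jsy]; rewrite /conductor/= mulrDr mulrCA.
by case: iJ => _; exact.
Qed.

Lemma closed_closure J : ideal J -> gabriel_closed (gabriel_closure J).
Proof.
move=> iJ x DJx; have ic := ideal_conductor.
apply: (gabriel_trans gD (ic _ x (ideal_closure iJ))) DJx _.
  exact: ic.
by move=> a; rewrite conductorM.
Qed.

Lemma closure1 J : gabriel_closure J 1 -> D J.
Proof.
rewrite /gabriel_closure/= (_ : conductor J 1 = J)//.
by apply/seteqP; split=> r; rewrite /conductor/= mulr1.
Qed.

Lemma prime_closed P : is_prime_ideal P -> ~ D P -> gabriel_closed P.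
Proof.
move=> pP nDP x DPx; apply: contrapT => nPx; apply: nDP.
apply: (gabriel_sub _ _ _ DPx); [|exact: prime_ideal..|].
  by apply: ideal_conductor; exact: prime_ideal.
by move=> r /(primeM pP)[].
Qed.

(** If [x * y] is in [L] and [y] is outside [P], then [(L :_R x)] contains [P],
    so it is in [D] and closedness gives [x \in L].  That the radical is [P] is
    the leastness of [P]. *)
Lemma closed_primary L P : elementwise_prufer -> ideal L -> gabriel_closed L ->
  is_prime_ideal P -> D P -> L `<=` P ->
  (forall Q, is_prime_ideal Q -> L `<=` Q -> P `<=` Q) ->
  is_primary_for P L.
Proof.
move=> pr iL cL pP DP LP least.
have rad : radical L = P.
  apply/seteqP; split=> [x [n /LP]|x Px]; first exact: primeX.
  apply: contrapT => nx.
  have [n Ln|Q [pQ LQ]] := @ex_prime_avoiding L x iL; first by apply: nx; exists n.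
  by apply; exact: least Px.
split=> //; split.
  by apply/proper_idealP; split=> // /LP; exact: prime_one.
move=> x y Lxy; rewrite rad; have [|nPy] := pselect (P y); first by right.
left; apply: cL; apply: (gabriel_sub _ _ _ DP).
- exact: prime_ideal.
- exact: ideal_conductor.
- by apply: (least_prime_sub_conductor pr iL pP least nPy); rewrite mulrC.
Qed.

(** The closure [J'] is proper, so it has a minimal prime [P]; if [P] is in the
    filter, [J'] has to be enlarged to a [P]-primary ideal without losing
    closedness.  Finiteness of the minimal primes gives an element [e] that is
    [1] modulo [P] and in all the others, and dividing [J'] by a power of [e]
    removes those other primes. *)
Lemma gabriel_obstruction J : elementwise_prufer ->
  (forall I : set R, is_proper_ideal I ->
     finite_set [set P | minimal_prime I P]) ->
  ideal J -> ~ D J ->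
  exists P, [/\ is_prime_ideal P, J `<=` P & ~ D P] \/
    [/\ is_prime_ideal P, D P & exists L,
      [/\ is_primary_for P L, gabriel_closed L, J `<=` L & exists2 m, P m & ~ L m]].
Proof.
move=> pr fin iJ nDJ; set J' := gabriel_closure J.
have iJ' : ideal J' by exact: ideal_closure.
have JJ' : J `<=` J' by exact: sub_closure.
have J'1 : ~ J' 1 by move=> /closure1.
have [n|Q0 [pQ0 J'Q0 _]] := @ex_prime_avoiding J' 1 iJ'; first by rewrite expr1n.
have [P [pP J'P minP] _] := ex_minimal_prime pQ0 J'Q0.
exists P; have [DP|nDP] := pselect (D P); last first.
  by left; split=> //; exact: subset_trans JJ' J'P.
right; split=> //.
have /finite_seqP[s Es] : finite_set [set P | minimal_prime J' P].
  by apply: fin; exact/proper_idealP.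
have [|e es P1e] := @comaximal_seq P [seq Q <- s | Q != P] (prime_ideal pP).
  move=> Q; rewrite mem_filter => /andP[/eqP QP Qs].
  have [pQ J'Q minQ] : minimal_prime J' Q.
    by have : [set` s] Q by []; rewrite -Es.
  split; first exact: prime_ideal.
  apply: incomparable_comaximal => // [PQ|QP'].
  - by apply: QP; rewrite (minQ _ pP).
  - by apply: QP; exact: minP.
have nPe : ~ P e by move=> Pe; exact: (prime_one_minus pP Pe).
(* [e * (1 - e)] is in every minimal prime of [J'], hence nilpotent modulo it. *)
have [N J'N] : radical J' (e * (1 - e)).
  apply: contrapT => nr.
  have [n ?|Q [pQ J'Q nQ]] := @ex_prime_avoiding J' (e * (1 - e)) iJ'.
    by apply: nr; exists n.
  apply: nQ; have [P' mP' P'Q] := ex_minimal_prime pQ J'Q; apply: P'Q.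
  have [->|P'P] := pselect (P' = P); first exact: idealMl (prime_ideal pP) _.
  have iP' : ideal P' by case: mP' => /prime_ideal.
  apply: idealMr => //; apply: es; rewrite mem_filter; apply/andP; split.
    exact/eqP.
  have : [set P | minimal_prime J' P] P' by []. 
  by rewrite Es.
(* A prime containing [L] contains [(1 - e) ^+ N], so avoids [e], so it contains
   none of the minimal primes other than [P]. *)
set L := conductor J' (e ^+ N).
have iL : ideal L by exact: ideal_conductor.
have cL : gabriel_closed L by apply: closed_conductor; exact: closed_closure.
have J'L : J' `<=` L by exact: sub_conductor.
have LP : L `<=` P by move=> r /J'P /(primeM pP)[//|/(primeX pP)/nPe].
have least Q : is_prime_ideal Q -> L `<=` Q -> P `<=` Q.
  move=> pQ LQ; have Q1e : Q (1 - e).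
    by apply: (primeX (n := N) pQ); apply: LQ; rewrite /L/conductor/= -exprMn mulrC.
  have [P' mP' P'Q] := ex_minimal_prime pQ (subset_trans J'L LQ).
  have [<-//|P'P] := pselect (P' = P).
  case: (prime_one_minus pQ (P'Q _ _) Q1e).
  apply: es; rewrite mem_filter; apply/andP; split; first exact/eqP.
  have : [set P | minimal_prime J' P] P' by [].
  by rewrite Es.
(* [P] inside [L] would put [L] in the filter, and a closed ideal of the filter
   contains [1]. *)
exists L; split=> //.
- exact: closed_primary.
- exact: subset_trans J'L.
- apply: contrapT => H; apply: (prime_one pP); apply: LP; apply: cL.
  apply: (gabriel_sub (prime_ideal pP)) DP; first exact: ideal_conductor.
  move=> m Pm; apply: (sub_conductor _ iL); apply: contrapT => Lm.
  by apply: H; exists m.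
Qed.

End Gabriel.
End Ideals.

(** * Submodules of the quotient field *)

Section Fractions.
Variable R : idomainType.
Local Notation K := {fraction R}.
Implicit Types (I : set K) (J L P : set R) (r s t : R) (x y z : K).

(** The colon ideal [(I :_R x)]. *)
Definition denominators I x : set R := [set r | I (r%:F * x)].

Lemma fractionP x : exists a b : R, b != 0 /\ b%:F * x = a%:F.
Proof.
elim/quotW: x => u; exists (frac u).1, (frac u).2.
split; first exact: denom_ratioP.
unlock FracField.tofrac; rewrite -[LHS]FracField.pi_mul; apply/eqmodP.
rewrite /= FracField.equivfE /FracField.mulf !numden_Ratio ?oner_neq0 ?mul1r ?denom_ratioP//.
by rewrite mulr1.
Qed.

Lemma tofrac_inj (a b : R) : a%:F = b%:F -> a = b.
Proof. by move=> /eqP; rewrite tofrac_eq => /eqP. Qed.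

Lemma embedP J (r : R) : embed J r%:F <-> J r.
Proof. by split=> [[s Js /tofrac_inj <-]|Jr]; last exists r. Qed.

Lemma submodule_embed J : ideal J -> is_submodule (embed J).
Proof.
case=> J0 Jl; split; first by exists 0; rewrite ?tofrac0.
move=> r _ _ [a Ja <-] [b Jb <-]; exists (r * a + b); first exact: Jl.
by rewrite tofracD tofracM.
Qed.

Lemma submoduleMl I r x : is_submodule I -> I x -> I (r%:F * x).
Proof. by case=> I0 Il Ix; rewrite -[_ * _]addr0; exact: Il. Qed.

Lemma ideal_denominators I x : is_submodule I -> ideal (denominators I x).
Proof.
case=> I0 Il; split; first by rewrite /denominators/= tofrac0 mul0r.
move=> r a b Ia Ib; rewrite /denominators/= tofracD tofracM mulrDl -mulrA.
exact: Il.
Qed.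

Lemma denominators_embed J (r : R) : denominators (embed J) r%:F = conductor J r.
Proof.
by apply/seteqP; split=> s; rewrite /denominators/conductor/= -tofracM => /embedP.
Qed.

(** Write [1 = a * u + b * v] with [u] and [v] in the inverse of the ideal
    [(a, b)], so that [a * u], [b * u], [a * v], [b * v] are in [R]; then
    [t = a * u] works, since [1 - t = b * v]. *)
Lemma prufer_elementwise : is_prufer R -> elementwise_prufer R.
Proof.
move=> pr a b.
have [/andP[/eqP -> /eqP ->]|] := boolP ((a == 0) && (b == 0)).
  by exists 0, 0, 0; rewrite !mulr0.
move=> ab0; pose g (i : 'I_2) := if i == ord0 then a else b.
have [|B [B0 Bl] EB] := pr 2%N g.
  move: ab0; rewrite negb_and => /orP[a0|b0]; first by exists ord0.
  by exists ord_max.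
have key x y : embed (fg_ideal g) x -> B y -> embed setT (x * y).
  move=> gx By; rewrite -EB; exists 1%N, (fun=> x), (fun=> y).
  by split=> //; rewrite big_ord1.
have Ba y : B y -> embed setT (a%:F * y).
  apply: key; exists a => //; exists (fun i => (i == ord0)%:R).
  by rewrite big_ord_recl big_ord1 /= mul1r mul0r addr0.
have Bb y : B y -> embed setT (b%:F * y).
  apply: key; exists b => //; exists (fun i => (i != ord0)%:R).
  by rewrite big_ord_recl big_ord1 /= mul1r mul0r add0r.
have : embed setT (1 : K) by exists 1; rewrite ?tofrac1.
rewrite -EB => -[n [f [h [gf Bh E1]]]].
have [u [v [Bu Bv E]]] : exists u v, [/\ B u, B v &
    \sum_(i < n) f i * h i = a%:F * u + b%:F * v].
  have BD x y : B x -> B y -> B (x + y).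
    by move=> Bx By; rewrite -[x]mul1r -(tofrac1 R); exact: Bl.
  have BM (r : R) x : B x -> B (r%:F * x).
    by move=> Bx; rewrite -[_ * _]addr0; exact: Bl.
  elim/big_ind: _ => [|x y [u [v [Bu Bv ->]]] [u' [v' [Bu' Bv' ->]]]|i _].
  - by exists 0, 0; rewrite !mulr0 addr0.
  - by exists (u + u'), (v + v'); split; [exact: BD..|ring].
  - have [_ [c ->] <-] := gf i; rewrite big_ord_recl big_ord1 /=.
    exists ((c ord0)%:F * h i), ((c (lift ord0 ord0))%:F * h i).
    by split; [exact: BM..|rewrite tofracD !tofracM; ring].
have [t _ Et] := Ba _ Bu; have [s _ Es] := Bb _ Bu.
have [q _ Eq] := Ba _ Bv; have [w _ Ew] := Bb _ Bv.
have Ew' : 1 - t = w.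
  apply: tofrac_inj; rewrite tofracB tofrac1 Et Ew E1 E; ring.
exists t, s, q; rewrite Ew'; split; apply: tofrac_inj; rewrite !tofracM.
  by rewrite Et Es; ring.
by rewrite Ew Eq; ring.
Qed.

Lemma prufer_fraction : elementwise_prufer R -> forall z, exists t r1 r2 : R,
  t%:F = r1%:F * z /\ (1 - t)%:F * z = r2%:F.
Proof.
move=> pr z; have [a [b [b0 E]]] := fractionP z.
have [t [r1 [r2 [E1 E2]]]] := pr a b; exists t, r1, r2.
have bF0 : b%:F != 0 by rewrite tofrac_eq0.
split; apply: (mulIf bF0).
  by rewrite -tofracM E1 tofracM -E; ring.
by rewrite -mulrA [z * _]mulrC E -!tofracM E2.
Qed.

(** * Localizations and their v-operation *)

Section Localization.
Variables (P : set R) (pP : is_prime_ideal P).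

Lemma prime_neq0 s : ~ P s -> s%:F != 0.
Proof.
rewrite tofrac_eq0 => Ps; apply/eqP => s0; apply: Ps.
by rewrite s0; case: (prime_ideal pP).
Qed.

Lemma localizationP z :
  localization P z <-> exists s, ~ P s /\ exists a, s%:F * z = a%:F.
Proof.
split=> [[a [s [Ps ->]]]|[s [Ps [a E]]]].
  by exists s; split=> //; exists a; rewrite mulrCA mulfV ?mulr1// prime_neq0.
exists a, s; split=> //; rewrite -E mulrAC mulfV ?mul1r//.
exact: prime_neq0.
Qed.

Lemma prod_localizationP I z : is_submodule I ->
  prod_sub I (localization P) z <-> exists s, ~ P s /\ I (s%:F * z).
Proof.
move=> sI; split=> [[n [f [g [If Pg ->]]]]|[s [Ps Isz]]]; last first.
  exists 1%N, (fun=> s%:F * z), (fun=> 1%:F / s%:F); split=> //.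
    by move=> _; exists 1, s.
  rewrite big_ord1 tofrac1 mul1r mulrAC mulfV ?mul1r//; exact: prime_neq0.
elim/big_ind: _ => [|x y [s [Ps Ix]] [t [Pt Iy]]|i _].
- by exists 1; split; [exact: prime_one|rewrite mulr0; case: sI].
- exists (s * t); split; first exact: primeMn.
  rewrite (_ : _ * _ = t%:F * (s%:F * x) + s%:F * (t%:F * y)).
    by case: (sI) => _; apply=> //; exact: submoduleMl.
  by rewrite tofracM; ring.
- have /localizationP[s [Ps [a E]]] := Pg i; exists s; split=> //.
  by rewrite mulrCA E mulrC; exact: submoduleMl.
Qed.

Lemma v_opP I z : is_submodule I ->
  v_op (localization P) (prod_sub I (localization P)) z <->
  forall y, (forall i, I i -> localization P (y * i)) -> localization P (z * y).
Proof.
move=> sI; split=> [vz y Iy|H _ [y Hy <-]].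
  apply: vz; exists y => // _ [i /(prod_localizationP _ sI)[s [Ps Isi]] <-].
  have /localizationP[t [Pt [a E]]] := Iy _ Isi.
  apply/localizationP; exists (t * s); split; first exact: primeMn.
  by exists a; rewrite -E tofracM; ring.
apply: H => i Ii; apply: Hy; exists i => //.
apply/prod_localizationP => //; exists 1; split; first exact: prime_one.
by rewrite tofrac1 mul1r.
Qed.

(** The contraction [m R_P \cap R]. *)
Definition loc_multiples (m : R) : set R :=
  [set r | exists s c, ~ P s /\ s * r = c * m].

Lemma ideal_loc_multiples m : ideal (loc_multiples m).
Proof.
split; first by exists 1, 0; rewrite mulr0 mul0r; split=> //; exact: prime_one.
move=> r u v [s [c [Ps E]]] [s' [c' [Ps' E']]].
exists (s * s'), (s' * r * c + s * c'); split; first exact: primeMn.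
rewrite (_ : _ * _ = s' * r * (s * u) + s * (s' * v)); last by ring.
by rewrite E E'; ring.
Qed.

(** In the valuation ring [R_P], the [v]-closure of [I R_P] is the intersection
    of the principal fractional ideals [y^-1 R_P] that contain it.  It misses
    [x] exactly when one of them does; with [m = (x * y)^-1], a non-unit, this
    means [I R_P] inside [m x R_P], that is [(I :_R x)] inside [m R_P]. *)
Lemma v_op_not_multiples I x : elementwise_prufer R -> is_submodule I ->
  v_op (localization P) (prod_sub I (localization P)) x <->
  forall m, P m -> m != 0 -> ~ denominators I x `<=` loc_multiples m.
Proof.
move=> pr sI; rewrite v_opP//; split=> [vx m Pm m0 Dm|H y Iy].
  have mF0 : m%:F != 0 by rewrite tofrac_eq0.
  have x0 : x != 0.
    apply/eqP => x0; have : denominators I x 1.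
      by rewrite /denominators/= x0 mulr0; case: sI.
    move=> /Dm[s [c [Ps E]]]; apply: Ps; rewrite -[s]mulr1 E.
    exact: idealMl (prime_ideal pP) _.
  (* Test [x] against [y = (x * m)^-1], which maps [I] into the localization;
     [x * y = m^-1] is not there. *)
  have /localizationP[s [Ps [a E]]] : localization P (x * (x^-1 * m%:F^-1)).
    apply: vx => i Ii; apply/localizationP.
    have [t [r1 [r2 [E1 E2]]]] := prufer_fraction pr (i / x).
    have [Pt|nPt] := pselect (P t); last first.
      have : denominators I x t.
        rewrite /denominators/= E1 -mulrA divfK//; exact: submoduleMl.
      move=> /Dm[s [c [Ps E]]]; case: (@primeMn _ P s t) => //.
      by rewrite E; exact: idealMl (prime_ideal pP) _.
    have : denominators I x r2.
      rewrite /denominators/= -E2 -mulrA divfK//; exact: submoduleMl.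
    move=> /Dm[s [c [Ps E]]]; exists (s * (1 - t)); split.
      by apply: primeMn => //; exact: prime_one_minus.
    exists c; apply: (mulIf mF0); rewrite -tofracM -E !tofracM -E2.
    transitivity (s%:F * ((1 - t)%:F * (i / x)) * (m%:F^-1 * m%:F)); first by ring.
    by rewrite mulVf ?mulr1.
  apply: Ps; rewrite mulVKf// in E.
  rewrite (_ : s = a * m); first exact: idealMl (prime_ideal pP) _.
  by apply: tofrac_inj; rewrite tofracM -E divfK.
(* As [x * y] is not in the valuation ring, its inverse [r1 / t] is in the
   maximal ideal. *)
apply: contrapT => nxy.
have [t [r1 [r2 [E1 E2]]]] := prufer_fraction pr (x * y).
have P1t : P (1 - t).
  by apply: contrapT => P1t; apply: nxy; apply/localizationP; exists (1 - t);
    split=> //; exists r2.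
have Pt : ~ P t by move=> Pt; exact: (prime_one_minus pP Pt).
have r10 : r1 != 0.
  by have := prime_neq0 Pt; rewrite E1 mulf_eq0 negb_or tofrac_eq0 => /andP[].
apply: (H r1) => //.
  apply: contrapT => Pr1; apply: nxy; apply/localizationP.
  by exists r1; split=> //; exists t.
move=> r Ir; have /localizationP[s [Ps [a E]]] := Iy _ Ir.
exists (s * t), a; split; first exact: primeMn.
apply: tofrac_inj; rewrite !tofracM E1 -E; ring.
Qed.

(** For [m \in P], some [j \in J] is not a multiple of [m] in the valuation ring
    [R_P], so [m] is a multiple of [j] there, and primary ideals are contracted
    from [R_P]. *)
Lemma prime_sub_primary L (J : set R) : elementwise_prufer R -> is_primary_for P L ->
  J `<=` L -> (forall m, P m -> m != 0 -> ~ J `<=` loc_multiples m) -> P `<=` L.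
Proof.
move=> pr [[/proper_idealP[iL _] primL] radL] JL H m Pm; apply: contrapT => Lm.
have m0 : m != 0 by apply: contra_notN Lm => /eqP ->; case: iL.
apply: (H m) => // j Jj; have [t [r1 [r2 [E1 E2]]]] := pr m j.
exists t, r1; split=> // Pt; apply: Lm.
have : L (m * (1 - t)) by rewrite mulrC E2; exact: idealMl (JL _ Jj).
by move=> /primL[//|]; rewrite radL => /(prime_one_minus pP Pt).
Qed.

End Localization.

(** If [m R_P \cap R] contains a member of the filter, so does every
    [m ^+ n R_P \cap R], because products of members are members; the ones with
    large [n] are inside the primary ideal [L]. *)
Lemma loc_multiples_nonmember (D : set (set R)) P L J m :
  gabriel_filter D -> is_prime_ideal P -> is_primary_for P L -> ~ D L ->
  P m -> ideal J -> J `<=` loc_multiples P m -> ~ D J.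
Proof.
move=> gD pP [[/proper_idealP[iL _] primL] radL] nDL Pm iJ Jm DJ.
have iM n := ideal_loc_multiples pP (m ^+ n).
have DM n : D (loc_multiples P (m ^+ n)).
  elim: n => [|n IH].
    apply: (gabriel_sub gD (@ideal_setT R)) (gabrielT gD) => // r _.
    by exists 1, r; rewrite expr0 mulr1 mul1r; split=> //; exact: prime_one.
  apply: (gabriel_trans gD iJ) => // j Jj; apply: (gabriel_sub gD) IH => //.
    exact: ideal_conductor.
  move=> r [s [c [Ps E]]]; have [s' [c' [Ps' E']]] := Jm _ Jj.
  exists (s * s'), (c * c'); split; first exact: primeMn.
  rewrite (_ : _ * _ = (s * r) * (s' * j)); last by ring.
  by rewrite E E' exprS; ring.
have [n Ln] : radical L m by rewrite radL.
apply: nDL; apply: (gabriel_sub gD) (DM n) => // r [s [c [Ps E]]].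
have : L (r * s) by rewrite mulrC E; exact: idealMl.
by move=> /primL[//|]; rewrite radL.
Qed.

(** * The Gabriel filter of a stable semistar operation *)

Section StableStar.
Variables (star : set K -> set K).
Hypotheses (semi : is_semistar star) (stab : is_stable star).

Definition star_dense : set (set R) := [set J | star (embed J) 1].

(** For nonzero [x], [(I :_R x)] is the intersection of [R] and [x^-1 I], so
    stability and homogeneity compute its star. *)
Lemma star_denominators I x : is_submodule I ->
  star I x <-> star_dense (denominators I x).
Proof.
case: semi => smod sext sid smon sscale sI.
have sT : is_submodule (embed [set: R]) by exact: submodule_embed.
have T1 : star (embed [set: R]) 1.
  by apply: sext => //; exists 1; rewrite ?tofrac1.
have [->|x0] := eqVneq x 0.
  split=> _; last by case: (smod _ sI).
  rewrite /star_dense/= (_ : denominators I 0 = setT)//.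
  by apply/seteqP; split=> // r _; rewrite /denominators/= mulr0; case: sI.
rewrite /star_dense/= (_ : embed (denominators I x) =
    embed setT `&` scale_sub x^-1 I).
  rewrite stab//; last first.
    case: sI => I0 Il; split; first by exists 0; rewrite ?mulr0.
    move=> r _ _ [y Iy <-] [z Iz <-]; exists (r%:F * y + z); first exact: Il.
    by ring.
  rewrite sscale//; split=> [Ix|[_ [y Iy E]]].
    by split=> //; exists x => //; rewrite mulVf.
  suff -> : x = y by [].
  by rewrite -[x]mulr1 -E mulVKf.
apply/seteqP; split=> [_ [r Ir <-]|_ [[r _ <-] [y Iy E]]].
  by split; [exists r|exists (r%:F * x); rewrite // mulrC mulfK].
by exists r; rewrite // /denominators/= -E mulrC mulVKf.
Qed.

Lemma star_embed J r : ideal J ->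
  star (embed J) r%:F <-> star_dense (conductor J r).
Proof.
move=> iJ; rewrite star_denominators; last exact: submodule_embed.
by rewrite denominators_embed.
Qed.

(** The hypothesis on [A] and [B] says that [A] is inside [star B]; idempotence
    then gives [star A] inside [star B]. *)
Lemma star_gabriel : gabriel_filter star_dense.
Proof.
case: semi => smod sext sid smon _; split.
  by apply: sext; [exact: submodule_embed|exists 1; rewrite ?tofrac1].
move=> A B iA iB DA DB; have sB := submodule_embed iB.
rewrite /star_dense/= sid//; apply: smon DA; [exact: submodule_embed|exact: smod|].
by move=> _ [a Aa <-]; apply/star_embed => //; exact: DB.
Qed.

Lemma contract_star J : ideal J ->
  contract (star (embed J)) = gabriel_closure star_dense J.
Proof. by move=> iJ; apply/seteqP; split=> r /(star_embed _ iJ). Qed.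

Lemma QSpecP P : QSpec star P <-> is_prime_ideal P /\ ~ star_dense P.
Proof.
have gD := star_gabriel.
split=> [[pP]|[pP nDP]]; rewrite /QSpec/= (contract_star (prime_ideal pP)).
  move=> E; split=> // DP; apply: (prime_one pP); rewrite E.
  rewrite /gabriel_closure/=; apply: gabriel_sub DP => //.
  - exact: prime_ideal.
  - by apply: ideal_conductor; exact: prime_ideal.
  - by apply: sub_conductor; exact: prime_ideal.
split=> //; apply/seteqP; split; last exact: prime_closed.
by apply: sub_closure => //; exact: prime_ideal.
Qed.

Lemma PsSpecP P : PsSpec star P <->
  [/\ is_prime_ideal P, star_dense P &
      exists2 L, is_primary_for P L & gabriel_closed star_dense L].
Proof.
have gD := star_gabriel.
split=> [[pP]|[pP DP [L pL cL]]].
  rewrite (contract_star (prime_ideal pP)) => E [L pL EL]; split=> //.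
    by apply: closure1; rewrite E.
  have /proper_idealP[iL _] : is_proper_ideal L by case: pL => -[].
  by exists L => // x Dx; rewrite -EL contract_star.
have iL : ideal L by case: pL => -[/proper_idealP[]].
split=> //; last first.
  exists L => //; rewrite contract_star//; apply/seteqP; split=> //.
  exact: sub_closure.
rewrite (contract_star (prime_ideal pP)); apply: ideal1.
  by apply: ideal_closure => //; exact: prime_ideal.
rewrite /gabriel_closure/=; apply: gabriel_sub DP => //.
- exact: prime_ideal.
- by apply: ideal_conductor; exact: prime_ideal.
- by apply: sub_conductor; exact: prime_ideal.
Qed.

End StableStar.
End Fractions.

(** * The normalized stable version *)

Theorem corollary4p6 (R : idomainType) :
  is_prufer R ->
  (forall I : set R, is_proper_ideal I ->
     finite_set [set P | minimal_prime I P]%classic) ->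
  forall star : set {fraction R} -> set {fraction R},
    is_semistar star -> is_stable star ->
    forall I : set {fraction R}, is_submodule I ->
      star I = normalized_stable star I.
Proof.
move=> /prufer_elementwise pr fin star semi stab I sI.
have gD := star_gabriel semi stab.
apply/seteqP; split=> [x /(star_denominators semi stab _ sI) Dx|x [Qx Psx]].
  have iJ := ideal_denominators x sI; split=> P /=.
    move=> /(QSpecP semi stab)[pP nDP]; apply/prod_localizationP => //.
    apply: contrapT => H; apply: nDP; apply: (gabriel_sub gD iJ) Dx.
      exact: prime_ideal.
    by move=> r Ir; apply: contrapT => Pr; apply: H; exists r.
  move=> /(PsSpecP semi stab)[pP _ [L pL cL]].
  apply/v_op_not_multiples => // m Pm _ Jm.
  have [[/proper_idealP[iL L1] _] _] := pL.
  apply: (loc_multiples_nonmember gD pP pL _ Pm iJ Jm) Dx => DL; apply: L1; apply: cL.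
  by apply: (gabriel_sub gD iL) DL; [exact: ideal_conductor|exact: sub_conductor].
apply/(star_denominators semi stab _ sI); apply: contrapT => nD.
have iJ := ideal_denominators x sI.
have [P [[pP JP nDP]|[pP DP [L [pL cL JL [m Pm Lm]]]]]] :=
    gabriel_obstruction gD pr fin iJ nD.
  have /Qx /(prod_localizationP pP _ sI)[s [Ps]] : QSpec star P by apply/QSpecP.
  by move=> /JP.
have /Psx /(v_op_not_multiples pP _ pr sI) H : PsSpec star P.
  by apply/PsSpecP => //; split=> //; exists L.
exact: Lm (prime_sub_primary pP pr pL JL H Pm).
Qed.
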